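(* For every finite connected graph $G$, $\delta(G)=\delta(\mathcal{H}(G))$, where $\mathcal{H}(G)$ denotes the injective hull of $G$. In particular, the class of $\delta$-hyperbolic graphs is closed under Hellification: if $G$ is $\delta$-hyperbolic then so is $\mathcal{H}(G)$.
   Context: All graphs are finite, undirected, connected, without loops or multiple edges, with the shortest-path metric $d_G$. A disk is $D_G(v,r)=\{u: d_G(u,v)\le r\}$. A graph is Helly if every family of pairwise intersecting disks has nonempty common intersection. The injective hull $\mathcal{H}(G)$ of $G$ is the unique minimal Helly graph containing $G$ as an isometric subgraph; concretely its vertices are the functions $f:V(G)\to\mathbb{Z}_{\ge 0}$ with $f(x)+f(y)\ge d_G(x,y)$ for all $x,y$ and such that for every $x$ there is $y$ with $f(x)+f(y)=d_G(x,y)$, two such functions being adjacent iff $\max_x|f(x)-g(x)|=1$; $G$ embeds via $z\mapsto d_G(z,\cdot)$. A graph is $\delta$-hyperbolic if for any four vertices $u,v,w,x$ the two largest of the sums $d(u,v)+d(w,x)$, $d(u,x)+d(v,w)$, $d(u,w)+d(v,x)$ differ by at most $2\delta$; $\delta(G)$ is the least such $\delta$. A class $\mathcal{C}$ is closed under Hellification if $G\in\mathcal{C}$ implies $\mathcal{H}(G)\in\mathcal{C}$. *)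

(* Defs.v *)
From mathcomp Require Import all_boot all_order all_algebra.
From mathcomp Require Import classical_sets reals.

Set Implicit Arguments.
Unset Strict Implicit.
Unset Printing Implicit Defensive.

Import Order.TTheory GRing.Theory Num.Theory.

Record sgraph := SGraph {
  vertex :> finType;
  adj : rel vertex;
  adj_sym : symmetric adj;
  adj_irr : irreflexive adj }.

Arguments adj {s} : rename.

Definition connected (G : sgraph) : Prop :=
  (0 < #|G|)%N /\ forall x y : G, connect adj x y.

Section Distance.
Variable G : sgraph.
Implicit Types (x y : G) (p : seq G).

Definition walk (k : nat) x y : bool :=
  [exists p : k.-tuple G, path adj x p && (last x p == y)].

(* Least length of a walk from x to y. Walk lengths below #|G| are the only
   ones that need inspecting; #|G| is the junk value when y cannot be reached
   from x, see [dist_leq] and [dist_walk]. *)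
Definition dist x y : nat := find (fun k => walk k x y) (iota 0 #|G|).

Lemma dist_le_card x y : (dist x y <= #|G|)%N.
Proof. by rewrite -[leqRHS](size_iota 0) find_size. Qed.

Lemma dist_leq x y p : path adj x p -> last x p = y -> (dist x y <= size p)%N.
Proof.
move=> xp lp; case: (ltnP (size p) #|G|) => [szp|]; last first.
  exact: leq_trans (dist_le_card x y).
rewrite leqNgt; apply/negP => /(before_find 0%N).
rewrite nth_iota // add0n => /negbT/negP; apply.
by rewrite /walk; apply/existsP; exists (in_tuple p); rewrite xp lp eqxx.
Qed.

Lemma dist_walk x y : connect adj x y ->
  (dist x y < #|G|)%N /\
  exists p, [/\ path adj x p, last x p = y & size p = dist x y].
Proof.
case/connectP => q0 xq0 ->; case: (shortenP xq0) => q xq uq _.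
have szq : (size q < #|G|)%N.
  by rewrite -[X in (X <= _)%N]/(size (x :: q)) -(card_uniqP uq) max_card.
have dlt : (dist x (last x q) < #|G|)%N.
  exact: leq_ltn_trans (dist_leq xq erefl) szq.
split=> //.
have hk : has (fun k => walk k x (last x q)) (iota 0 #|G|).
  by rewrite has_find size_iota.
have := nth_find 0%N hk; rewrite -/(dist _ _) nth_iota // add0n.
by rewrite /walk; case/existsP => p /andP[xp /eqP lp]; exists p; rewrite size_tuple.
Qed.

End Distance.

Section Hyperbolicity.
Variables (R : realType) (G : sgraph).
Local Open Scope ring_scope.

(* The three four-point sums, in nonincreasing order. *)
Definition four_point_sums (u v w x : G) : seq nat :=
  sort geq [:: (dist u v + dist w x)%N;
               (dist u x + dist v w)%N;
               (dist u w + dist v x)%N].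

Definition hyperbolic (delta : R) : Prop :=
  forall u v w x : G,
    let s := four_point_sums u v w x in
    (nth 0%N s 0)%:R - (nth 0%N s 1)%:R <= 2 * delta.

(* The infimum is a minimum for nonempty graphs, see [hyperbolicity_least]. *)
Definition hyperbolicity : R := inf [set delta : R | hyperbolic delta]%classic.

Lemma hyperbolicity_least : (0 < #|G|)%N ->
  hyperbolic hyperbolicity /\
  forall delta : R, hyperbolic delta -> hyperbolicity <= delta.
Proof.
case/card_gt0P => z _.
have lb : has_lbound [set delta : R | hyperbolic delta]%classic.
  exists 0 => d /(_ z z z z) /=.
  rewrite /four_point_sums; set a := (_ + _)%N.
  have -> : sort geq [:: a; a; a] = [:: a; a; a].
    by rewrite sorted_sort //= ?leqnn // => i j k ji kj; apply: leq_trans kj ji.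
  by rewrite /= subrr pmulr_rge0.
have ne : ([set delta : R | hyperbolic delta] !=set0)%classic.
  exists #|G|%:R => u v w x /=; rewrite lerBlDr.
  apply: ler_wpDr; first exact: ler0n.
  rewrite -natrM ler_nat.
  set s := four_point_sums u v w x.
  have /(all_nthP 0%N) : all (fun k => k <= 2 * #|G|)%N s.
    by rewrite all_sort /= mul2n -addnn !leq_add ?dist_le_card.
  by apply; rewrite size_sort.
split=> [u v w x /=|d hd]; last exact: ge_inf.
rewrite mulrC -ler_pdivrMr //; apply: lb_le_inf => // d hd.
by rewrite ler_pdivrMr // mulrC; exact: hd.
Qed.

End Hyperbolicity.

Section InjectiveHull.
Variable G : sgraph.

Definition extremal (f : G -> nat) : bool :=
  [forall x, forall y, dist x y <= f x + f y]%N &&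
  [forall x, exists y, f x + f y == dist x y]%N.

(* Extremal functions take values at most #|G| ([extremal_le_card]), so
   bounding the codomain loses none of them ([hull_vertex_of]) and makes
   the vertex set a finite type. *)
Definition hull_vertex :=
  {f : {ffun G -> 'I_#|G|.+1} | extremal (fun x => f x : nat)}.

Definition hull_val (f : hull_vertex) (x : G) : nat := val f x.

Definition hull_adj (f g : hull_vertex) : bool :=
  (\max_(x : G) `|hull_val f x - hull_val g x|)%N == 1%N.

Lemma hull_adj_sym : symmetric hull_adj.
Proof. by move=> f g; rewrite /hull_adj; under eq_bigr do rewrite distnC. Qed.

Lemma hull_adj_irr : irreflexive hull_adj.
Proof. by move=> f; rewrite /hull_adj big1 // => x _; rewrite subrr. Qed.

Definition injective_hull : sgraph := SGraph hull_adj_sym hull_adj_irr.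

Lemma extremal_le_card f : extremal f -> forall x, (f x <= #|G|)%N.
Proof.
case/andP => _ /forallP ex x; have /existsP[y /eqP fxy] := ex x.
by apply: leq_trans (dist_le_card x y); rewrite -fxy leq_addr.
Qed.

Lemma hull_vertex_of f : extremal f ->
  exists v : injective_hull, hull_val v =1 f.
Proof.
move=> ef; pose g : {ffun G -> 'I_#|G|.+1} := [ffun x => inord (f x)].
have gE x : (g x : nat) = f x by rewrite ffunE inordK // ltnS extremal_le_card.
have eg : extremal (fun x => g x : nat).
  case/andP: ef => /forallP e1 /forallP e2; apply/andP; split; apply/forallP => x.
    by apply/forallP => y; rewrite !gE; apply: (forallP (e1 x)).
  by have /existsP[y fy] := e2 x; apply/existsP; exists y; rewrite !gE.
by exists (exist _ g eg).
Qed.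

End InjectiveHull.

Definition closed_under_hellification (C : sgraph -> Prop) : Prop :=
  forall G : sgraph, C G -> C (injective_hull G).

(* Main.v *)
(** The sup metric on extremal functions is the graph metric of the hull: for
    extremal [f], [g] at sup distance [n + 1], the pointwise minimum of [f + 1]
    and [g + n] still dominates the distance of [G], and any extremal function
    below it is at distance at most [1] from [f] and at most [n] from [g].

    Any two vertices [f], [g] of the hull lie on a geodesic between two vertices
    of [G]: if [f x - g x] is their distance and [f x + f y = d(x, y)], then
    [d(y, x) = f y + d(f, g) + g x].  Extending the pairs [u, v]
    and [w, x] to vertices of [G] in this way increases [d(u, v) + d(w, x)] by
    some [s] and the two other four-point sums by at most [s], so the four-point
    inequality of [G] passes to the hull. *)
Require Import Defs.
From mathcomp Require Import all_boot all_order all_algebra.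
From mathcomp Require Import reals.
From mathcomp Require Import zify lra.

Set Implicit Arguments.
Unset Strict Implicit.
Unset Printing Implicit Defensive.

Import Order.TTheory GRing.Theory Num.Theory.

Section GraphMetric.
Variable G : sgraph.
Hypothesis cG : connected G.
Implicit Types x y z : G.

Lemma dist_path x y :
  exists p, [/\ path adj x p, last x p = y & size p = dist x y].
Proof. exact: (dist_walk (cG.2 x y)).2. Qed.

Lemma distxx x : dist x x = 0%N.
Proof. by apply/eqP; rewrite -leqn0; apply: (@dist_leq _ _ _ [::]). Qed.

Lemma dist_triangle y x z : (dist x z <= dist x y + dist y z)%N.
Proof.
have [p [xp lp <-]] := dist_path x y; have [q [yq lq <-]] := dist_path y z.
by rewrite -size_cat; apply: dist_leq; rewrite ?cat_path ?last_cat lp // xp.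
Qed.

Lemma dist_sym x y : dist x y = dist y x.
Proof.
suff le (a b : G) : (dist a b <= dist b a)%N by apply/eqP; rewrite eqn_leq !le.
have [p [bp lp <-]] := dist_path b a.
rewrite -(size_belast b p) -size_rev; apply: dist_leq.
  by rewrite -lp (@eq_path _ adj (fun u v => adj v u)) ?rev_path // => u v;
    rewrite adj_sym.
by case: p bp lp => [|c p] //= _ _; rewrite rev_cons last_rcons.
Qed.

End GraphMetric.

Section Extremal.
Variable G : sgraph.

Lemma extremalP (f : G -> nat) :
  reflect ((forall x y, dist x y <= f x + f y)%N /\
           (forall x, exists y, (f x + f y)%N = dist x y)) (extremal f).
Proof.
apply: (iffP andP) => -[h1 h2]; split.
- by move=> x y; apply: (forallP (forallP h1 x)).
- by move=> x; have /existsP[y /eqP] := forallP h2 x; exists y.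
- by apply/forallP => x; apply/forallP.
- by apply/forallP => x; have [y ?] := h2 x; apply/existsP; exists y; apply/eqP.
Qed.

(** Descent on the sum of the values: at a point [x] with no tight partner, [u x] can drop by one
    without losing domination. *)
Lemma extremal_below (u : G -> nat) : connected G ->
    (forall x y, dist x y <= u x + u y)%N ->
  exists2 f, extremal f & forall x, (f x <= u x)%N.
Proof.
move=> cG; have [n] := ubnP (\sum_x u x)%N.
elim: n u => // n IHn u; rewrite ltnS => ltn du.
have [eu|] := boolP (extremal u); first by exists u.
rewrite /extremal negb_and => /orP[/negP[]|].
  by apply/forallP => x; apply/forallP.
case/forallPn => x /existsPn nx.
have lt y : (dist x y < u x + u y)%N by rewrite ltn_neqAle eq_sym nx du.
(* Strictness at [y = x] reads [0 < u x + u x], so the predecessor taken next is a true decrease. *)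
have ux : (0 < u x)%N by have := lt x; rewrite distxx; lia.
pose v y := if y == x then (u x).-1 else u y.
have vu y : (v y <= u y)%N by rewrite /v; case: eqP => [->|//]; exact: leq_pred.
have [||f ef fv] := IHn v.
- apply: leq_trans ltn; rewrite (bigD1 x) //= [X in (_ < X)%N](bigD1 x) //=.
  rewrite {1}/v eqxx -addSn prednK // leq_add2l.
  by apply: leq_sum => y _; apply: vu.
- move=> y z; rewrite /v; case: eqP => [->|_]; case: eqP => [->|_] //.
  + by rewrite distxx.
  + by have := lt z; lia.
  + by have := lt y; rewrite dist_sym //; lia.
by exists f => // y; apply: leq_trans (fv y) (vu y).
Qed.

End Extremal.

Section HullMetric.
Variable G : sgraph.
Hypothesis cG : connected G.
Local Notation H := (injective_hull G).
Implicit Types f g h : H.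

Definition sup_dist f g : nat := (\max_(x : G) `|hull_val f x - hull_val g x|)%N.

Lemma hull_extremal f : extremal (hull_val f).
Proof. exact: valP f. Qed.

Lemma hull_val_inj f g : hull_val f =1 hull_val g -> f = g.
Proof. by move=> fg; apply/val_inj/ffunP => x; apply/val_inj/fg. Qed.

Lemma sup_distP f g n :
  reflect (forall x, hull_val f x <= hull_val g x + n /\
                     hull_val g x <= hull_val f x + n)%N (sup_dist f g <= n)%N.
Proof.
apply: (iffP (bigmax_leqP _ _ _)) => h x; first by have := h x isT; lia.
by move=> _; have := h x; lia.
Qed.

(* For extremal functions, a one-sided bound is two-sided. *)
Lemma sup_dist_le f g n :
  (forall x, hull_val f x <= hull_val g x + n)%N -> (sup_dist f g <= n)%N.
Proof.
move=> fg; apply/sup_distP => x; split=> //.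
(* For a partner [y] tight with [x] under [g], [g x = d(x, y) - g y <= f x + (f y - g y)]. *)
have /extremalP[_ /(_ x)[y gxy]] := hull_extremal g.
have /extremalP[/(_ x y) fxy _] := hull_extremal f.
by have := fg y; lia.
Qed.

Lemma sup_dist_eq0 f g : (sup_dist f g <= 0)%N -> f = g.
Proof. by move=> /sup_distP fg; apply: hull_val_inj => x; have := fg x; lia. Qed.

Lemma sup_dist_path n f g : (sup_dist f g <= n)%N ->
  exists p, [/\ path adj f p, last f p = g & (size p <= n)%N].
Proof.
elim: n f => [|n IHn] f fg; first by exists [::]; rewrite (sup_dist_eq0 fg).
have [/IHn[p [fp lp sp]]|gtn] := leqP (sup_dist f g) n.
  by exists p; split=> //; apply: leqW.
have /extremalP[df _] := hull_extremal f.
have /extremalP[dg _] := hull_extremal g.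
have /sup_distP fgn := fg.
(* In the mixed case [(f x + 1) + (g y + n)], domination holds because [f y <= g y + n + 1]. *)
pose u x := minn (hull_val f x).+1 (hull_val g x + n).
have [|h0 eh0 h0u] := @extremal_below _ u cG.
  move=> x y; have := df x y; have := dg x y; have := fgn x; have := fgn y.
  by rewrite /u; lia.
have [h hE] := hull_vertex_of eh0.
have hf : (sup_dist h f <= 1)%N.
  by apply: sup_dist_le => x; rewrite hE; have := h0u x; rewrite /u; lia.
have hg : (sup_dist h g <= n)%N.
  by apply: sup_dist_le => x; rewrite hE; have := h0u x; rewrite /u; lia.
have [p [hp lp sp]] := IHn h hg.
exists (h :: p); split=> //=; rewrite hp andbT hull_adj_sym.
rewrite /hull_adj -/(sup_dist h f) eqn_leq hf lt0n -leqn0.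
(* If [h] were [f], then [f] would be within [n] of [g], the case set aside above; so [h] is a
   proper neighbour of [f]. *)
by apply/negP => /sup_dist_eq0 hf0; move: gtn; rewrite -hf0 ltnNge hg.
Qed.

Lemma sup_dist_size f p : path adj f p -> (sup_dist f (last f p) <= size p)%N.
Proof.
elim: p f => [|h p IHp] f /=; first by move=> _; apply: sup_dist_le => x; lia.
case/andP => fh /IHp /sup_distP hp.
have /sup_distP fh1 : (sup_dist f h <= 1)%N by apply: eq_leq (eqP fh).
apply: sup_dist_le => x; apply: leq_trans (fh1 x).1 _.
by rewrite addn1 addnS ltnS; exact: (hp x).1.
Qed.

Lemma injective_hull_connected : connected H.
Proof.
split=> [|f g]; last first.
  have [p [fp lp _]] := sup_dist_path (leqnn (sup_dist f g)).
  by apply/connectP; exists p.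
(* Nonemptiness: the constant [#|G|] dominates every distance, so some extremal function lies below
   it. *)
have [f ef _] := @extremal_below _ (fun _ => #|G|) cG
  (fun x y => leq_trans (dist_le_card x y) (leq_addr _ _)).
by have [v _] := hull_vertex_of ef; apply/card_gt0P; exists v.
Qed.

Lemma hull_distE f g : dist f g = sup_dist f g.
Proof.
apply/eqP; rewrite eqn_leq; apply/andP; split.
  have [p [fp lp sp]] := sup_dist_path (leqnn (sup_dist f g)).
  exact: leq_trans (dist_leq fp lp) sp.
have [p [fp <- <-]] := dist_path injective_hull_connected f g.
exact: sup_dist_size.
Qed.

Lemma extremal_dist (z : G) : extremal (dist z).
Proof.
apply/extremalP; split=> [x y|x].
  by rewrite (dist_sym cG z x) dist_triangle.
by exists z; rewrite distxx addn0 dist_sym.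
Qed.

(** The Kuratowski embedding. Its first property reads the value [f z] as a distance in the hull;
    the isometry is the case [f = e w]. *)
Lemma hull_isometry :
  exists2 e : G -> H, (forall z f, dist (e z) f = hull_val f z) &
                      forall z w, dist (e z) (e w) = dist z w.
Proof.
have ex z : exists v : H, [forall x, hull_val v x == dist z x].
  by have [v vE] := hull_vertex_of (extremal_dist z); exists v; apply/forallP => x;
    rewrite vE.
pose e z := xchoose (ex z).
have eE z x : hull_val (e z) x = dist z x.
  by apply/eqP; apply: (forallP (xchooseP (ex z))).
have ed z f : dist (e z) f = hull_val f z.
  rewrite hull_distE; apply/eqP; rewrite eqn_leq; apply/andP; split.
    have /extremalP[df ef] := hull_extremal f.
    apply/sup_distP => x; rewrite eE; split.
      by rewrite addnC.
    have [y fxy] := ef x; have := dist_triangle cG z x y.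
    by have := df z y; rewrite (dist_sym cG x z); lia.
  (* The supremum is reached at [z] itself, where [e z] vanishes. *)
  by have /sup_distP/(_ z) := leqnn (sup_dist (e z) f); rewrite eE distxx; lia.
by exists e => // z w; rewrite ed eE dist_sym.
Qed.

(** Take [z] where the sup distance is attained and a partner tight with [z] for the larger of the
    two functions; that function's value at [z] splits as [d(f, g)] plus the smaller value. *)
Lemma hull_geodesic f g : exists x y : G,
  dist x y = (hull_val f x + dist f g + hull_val g y)%N.
Proof.
have [z zE] := @bigop.eq_bigmax G (fun z => `|hull_val f z - hull_val g z|)%N cG.1.
rewrite -/(sup_dist f g) -hull_distE in zE.
have [gf|fg] := leqP (hull_val g z) (hull_val f z).
  have /extremalP[_ /(_ z)[y fzy]] := hull_extremal f.
  by exists y, z; rewrite dist_sym // -fzy; lia.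
have /extremalP[_ /(_ z)[y gzy]] := hull_extremal g.
by exists z, y; rewrite -gzy; lia.
Qed.

End HullMetric.

Section FourPoint.
Variable R : realType.
Local Open Scope ring_scope.

(** The bound on the largest number carries the content; the gap is nonnegative, so bounding it by
    [d] forces [0 <= d] and the other two follow. *)
Lemma sort3_gap (a b c : nat) (d : R) :
  let s := sort geq [:: a; b; c] in
  (nth 0%N s 0)%:R - (nth 0%N s 1)%:R <= d <->
  [/\ a%:R <= (maxn b c)%:R + d, b%:R <= (maxn a c)%:R + d &
      c%:R <= (maxn a b)%:R + d].
Proof.
rewrite /= /sort /=.
case: (leqP b a) => ba /=; case: (leqP c a) => ca /=;
  case: (leqP c b) => cb /=; try lia.
all: move: ba ca cb; rewrite -?(ler_nat R) -?(ltr_nat R) => *.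
all: by split=> [?|[*]]; [split|]; lra.
Qed.

(** One inequality suffices: permuting the four vertices brings each of the three sums to the
    left-hand side. *)
Lemma hyperbolicP (G : sgraph) (delta : R) : connected G ->
  hyperbolic G delta <->
  forall u v w x : G, (dist u v + dist w x)%:R <=
    (maxn (dist u x + dist v w) (dist u w + dist v x))%:R + 2 * delta.
Proof.
move=> cG; split=> h u v w x; first by have /sort3_gap[] := h u v w x.
apply/sort3_gap; split; first exact: h.
  by have := h u x v w; rewrite (dist_sym cG x v) (dist_sym cG x w) maxnC.
by have := h u w v x; rewrite (dist_sym cG w v) (dist_sym cG w x) maxnC.
Qed.

Lemma hyperbolic_isometric_geodesic (G H : sgraph) (e : G -> H) (delta : R) :
    connected G -> connected H ->
    (forall x y, dist (e x) (e y) = dist x y) ->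
    (forall f g, exists x y,
       dist x y = (dist (e x) f + dist f g + dist g (e y))%N) ->
  hyperbolic G delta <-> hyperbolic H delta.
Proof.
move=> cG cH eE geo; rewrite !hyperbolicP //; split=> h u v w x; last first.
  by rewrite -!eE; apply: h.
have [u' [v' uv]] := geo u v; have [w' [x' wx]] := geo w x.
have tri a b c d : (dist a b <= dist (e a) c + dist c d + dist d (e b))%N.
  rewrite -eE; apply: leq_trans (dist_triangle cH c _ _) _.
  by rewrite -addnA leq_add2l dist_triangle.
pose s := (dist (e u') u + dist v (e v') + (dist (e w') w + dist x (e x')))%N.
have uvwx : (dist u' v' + dist w' x' = dist u v + dist w x + s)%N.
  by rewrite uv wx /s; lia.
(* Each cross sum involves each of the four extended endpoints once, so the triangle inequality
   charges every extension once, [s] in total. *)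
have mle : (maxn (dist u' x' + dist v' w') (dist u' w' + dist v' x') <=
            maxn (dist u x + dist v w) (dist u w + dist v x) + s)%N.
  have := tri u' x' u x; have := tri v' w' v w.
  have := tri u' w' u w; have := tri v' x' v x.
  by rewrite /s (dist_sym cH (e v')) (dist_sym cH w (e w')); lia.
have := h u' v' w' x'; move: mle; rewrite uvwx -(ler_nat R) !(natrD _ _ s).
lra.
Qed.

End FourPoint.

Lemma hyperbolic_injective_hull (R : realType) (G : sgraph) (delta : R) :
  connected G -> hyperbolic G delta <-> hyperbolic (injective_hull G) delta.
Proof.
move=> cG; have [e eE eiso] := hull_isometry cG.
have cH := injective_hull_connected cG.
apply: (hyperbolic_isometric_geodesic _ cG cH eiso) => f g.
have [x [y xy]] := hull_geodesic cG f g.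
by exists x, y; rewrite xy eE (dist_sym cH g) eE.
Qed.

Theorem theorem2 (R : realType) :
  (forall G : sgraph, connected G ->
     hyperbolicity R G = hyperbolicity R (injective_hull G)) /\
  (forall delta : R,
     closed_under_hellification
       (fun G : sgraph => connected G /\ hyperbolic G delta)).
Proof.
split=> [G cG|delta G [cG hG]]; last first.
  by split; [exact: injective_hull_connected|exact/(hyperbolic_injective_hull _ cG)].
have [hG leG] := hyperbolicity_least R cG.1.
have [hH leH] := hyperbolicity_least R (injective_hull_connected cG).1.
(* Both graphs admit the same constants, so each least constant bounds the other from below. *)
apply/le_anti/andP; split; first exact/leG/(hyperbolic_injective_hull _ cG).
exact/leH/(hyperbolic_injective_hull _ cG).
Qed.
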